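(* Let $n$ and $N$ be positive integers. Suppose that each of the numbers $1,2,\ldots,N$ has one of $n$ colours assigned to it, and that there are no monochromatic solutions to the equation $$x_1+2x_2+x_3=y_1+y_2.$$ Then $N\le e\,(2n)!$.
   Context: A monochromatic solution of an equation, with respect to a colouring of $\{1,\ldots,N\}$, is an assignment of values in $\{1,\ldots,N\}$, all of the same colour, to the variables such that the equation holds; the values of the variables need not be distinct. Here $e$ is the base of the natural logarithm. *)

(* Defs.v *)
From mathcomp Require Import all_boot.

Set Implicit Arguments.
Unset Strict Implicit.
Unset Printing Implicit Defensive.

(* A colouring of {1, ..., N} is represented by a function on nat whose values
   outside {1, ..., N} are never inspected. *)
Definition monochromatic_in (n N : nat) (c : nat -> 'I_n) (s : seq nat) : Prop :=
  exists k : 'I_n, forall x : nat, x \in s -> 1 <= x <= N /\ c x = k.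

(* The values of the variables need not be distinct. *)
Definition monochromatic_solution (n N : nat) (c : nat -> 'I_n)
    (x1 x2 x3 y1 y2 : nat) : Prop :=
  monochromatic_in N c [:: x1; x2; x3; y1; y2] /\
  x1 + 2 * x2 + x3 = y1 + y2.

(* Main.v *)
Require Import Defs.
From mathcomp Require Import all_boot all_order all_algebra.
From mathcomp Require Import reals sequences exp.
From mathcomp Require Import zify.

(* Taking x1 = x3 = x, x2 = z and y1 = y2 = x + z, every monochromatic Schur
   triple x, z, x + z gives a monochromatic solution.  Schur's argument then
   bounds N: among the elements of one colour class k, the differences from the
   least element lie outside k, and so do the differences of these differences,
   so one colour can be removed at the cost of dividing the size by the number
   of colours.  The resulting bound 3 n! is at most 2 (2n)! <= e (2n)!. *)

Set Implicit Arguments.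
Unset Strict Implicit.
Unset Printing Implicit Defensive.

Import Order.TTheory GRing.Theory Num.Theory.
Local Open Scope ring_scope.

Lemma size_le_colour_classes (n b : nat) (c : nat -> 'I_n) (K : {set 'I_n})
    (s : seq nat) :
    (forall x, x \in s -> c x \in K) ->
    (forall k, k \in K -> (count (fun x => c x == k) s <= b)%N) ->
  (size s <= #|K| * b)%N.
Proof.
move=> sK small; rewrite -sum_nat_const.
apply: leq_trans (leq_sum _ small).
rewrite -sum1_size big_seq (partition_big c (mem K)) //=.
by apply: leq_sum => k _; rewrite -big_seq_cond sum1_count.
Qed.

(* The term m == 0 strengthens the base case, where s is empty: without it the
   inequality for m = 0 would be too weak to give the one for m = 1. *)
Lemma schur_difference_bound (n N m : nat) (c : nat -> 'I_n)
    (sum_free : forall x y, (0 < x)%N -> (0 < y)%N -> (x + y <= N)%N ->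
       c x = c y -> c (x + y)%N <> c x)
    (K : {set 'I_n}) (s : seq nat) :
    #|K| = m -> path ltn 0%N s -> (forall x, x \in s -> (x <= N)%N) ->
    (forall x y : nat, x \in 0%N :: s -> y \in s -> (x < y)%N -> c (y - x)%N \in K) ->
  (size s + 2 + (m == 0) <= 3 * m`!)%N.
Proof.
elim: m K s => [|m IH] K s cardK s_lt sN diffK.
  (* With no colour left [s] is empty: its first element minus 0 would have a colour in [K]. *)
  move/eqP: cardK; rewrite cards_eq0 => /eqP K0.
  case: s s_lt sN diffK => // y s /= /andP[y_gt0 _] _ /(_ 0%N y).
  by rewrite K0 !mem_head inE => /(_ isT isT y_gt0).
have s_gt0 x : x \in s -> (0 < x)%N.
  by move/(order_path_min ltn_trans)/allP: s_lt; apply.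
have sK x : x \in s -> c x \in K.
  by move=> xs; rewrite -[x]subn0 diffK ?mem_head ?s_gt0.
(* A nonempty colour class has one element more than its list of differences from the least element,
   which the induction hypothesis bounds; hence [- 1] and not [- 2]. *)
have bound : (size s <= m.+1 * (3 * m`! - 1 - (m == 0)))%N.
  rewrite -cardK; apply: (size_le_colour_classes sK) => k kK.
  rewrite -size_filter.
  set t := filter _ s.
  have t_s x : x \in t -> x \in s /\ c x = k.
    by rewrite mem_filter => /andP[/eqP].
  have : sorted ltn t by apply: sorted_filter (path_sorted s_lt); exact: ltn_trans.
  case: t t_s => [|x0 t] t_s /= x0t; first by case: (m); lia.
  have [x0s cx0] := t_s x0 (mem_head _ _).
  have x0_lt x : x \in t -> (x0 < x)%N.
    by move/(order_path_min ltn_trans)/allP: x0t; apply.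
  have t_in x : x \in t -> x \in s /\ c x = k.
    by move=> xt; apply: t_s; rewrite inE xt orbT.
  suff : (size [seq x - x0 | x <- t]%N + 2 + (m == 0) <= 3 * m`!)%N
    by rewrite size_map; lia.
  have t'_lt : path ltn 0%N [seq x - x0 | x <- t]%N.
    (* Truncated subtraction of [x0] is strictly increasing only from [x0] on. *)
    rewrite -{1}(subnn x0) (path_map (f := subn^~ x0)).
    apply: (sub_in_path (P := fun x => x0 <= x)%N) _ x0t => [x y|].
      by rewrite -!topredE /=; lia.
    by rewrite /= leqnn; apply/allP => x /x0_lt/ltnW.
  apply: (IH (K :\ k)) t'_lt _ _.
  - by move: (cardsD1 k K); rewrite kK cardK; lia.
  - by move=> _ /mapP[x /t_in[/sN]] xN _ ->; lia.
  (* If [y - x] had colour [k], then [x + (y - x) = y] would be a Schur triple of colour [k]. *)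
  have diff (x y : nat) : x \in x0 :: t -> y \in t -> (x < y)%N ->
      c (y - x)%N \in K :\ k.
    move=> /t_s[xs cx] /t_in[ys cy] xy; rewrite !inE diffK ?inE ?xs ?orbT //.
    rewrite andbT; apply/eqP => cyx.
    have := @sum_free x (y - x)%N (s_gt0 _ xs).
    by rewrite subn_gt0 subnKC ?(ltnW xy) // cyx cx cy => /(_ xy (sN _ ys) erefl).
  move=> x' _ x'_in /mapP[y yt ->].
  have [x xt ->] : exists2 x : nat, x \in x0 :: t & x' = (x - x0)%N.
    move: x'_in; rewrite inE => /orP[/eqP->|/mapP[x xt ->]].
      by exists x0; rewrite ?mem_head ?subnn.
    by exists x; rewrite // inE xt orbT.
  have x0x : (x0 <= x)%N by move: xt; rewrite inE => /orP[/eqP->|/x0_lt/ltnW].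
  move=> lt_xy; have -> : (y - x0 - (x - x0) = y - x)%N by lia.
  by apply: diff => //; lia.
rewrite factS.
(* Multiplied out, the [- 1] becomes [- m.+1], which covers the required 2 unless [m] is 0; there
   the term [m == 0] makes up for it. *)
case: m bound {IH cardK} => [|m]; first by rewrite !fact0; lia.
by have := fact_gt0 m.+1; rewrite /= subn0; move: (m.+1)`! => f; nia.
Qed.

(** For the list 1, ..., N with all colours allowed, the condition on differences is trivial. *)
Lemma schur_bound (n N : nat) (c : nat -> 'I_n)
    (sum_free : forall x y, (0 < x)%N -> (0 < y)%N -> (x + y <= N)%N ->
       c x = c y -> c (x + y)%N <> c x) :
  (N + 2 <= 3 * n`!)%N.
Proof.
rewrite -[X in (X + 2)%N](size_iota 1); apply: leq_trans (leq_addr (n == 0) _) _.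
apply: (schur_difference_bound sum_free (K := setT)).
- by rewrite cardsT card_ord.
- exact: (iota_ltn_sorted 0 N.+1).
- by move=> x; rewrite mem_iota; lia.
- by move=> *; rewrite inE.
Qed.

Theorem theorem7 (R : realType) (n N : nat) (n_gt0 : (0 < n)%N)
    (N_gt0 : (0 < N)%N) (c : nat -> 'I_n)
    (no_sol : ~ exists x1 x2 x3 y1 y2 : nat,
        monochromatic_solution N c x1 x2 x3 y1 y2) :
  N%:R <= expR 1 * ((2 * n)`!)%:R :> R.
Proof.
have sum_free x y : (0 < x)%N -> (0 < y)%N -> (x + y <= N)%N ->
    c x = c y -> c (x + y)%N <> c x.
  move=> x_gt0 y_gt0 xyN cxy cxy'; apply: no_sol.
  exists x, y, x, (x + y)%N, (x + y)%N; split; last by lia.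
  by exists (c x) => z; rewrite !inE => /or4P[||| /orP[]] /eqP->; split => //; lia.
have N_le : (N <= 2 * (2 * n)`!)%N.
  have := schur_bound sum_free.
  suff : (2 * n`! <= (2 * n)`!)%N by lia.
  case: n n_gt0 {c no_sol sum_free} => // n _.
  (* In (2n+2)! = (2n+2)(2n+1)! the factors are at least 2 and (n+1)!. *)
  have -> : (2 * n.+1 = (2 * n).+2)%N by lia.
  rewrite (factS (2 * n).+1); apply: leq_mul => //.
  by rewrite leq_fact //; lia.
have e_ge2 : 2 <= expR 1 :> R by rewrite -[2](natrD R 1 1) expR_ge1Dx.
apply: le_trans (ler_wpM2r (ler0n _ _) e_ge2).
by rewrite -natrM ler_nat.
Qed.
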